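(* Let $\rho_0:=(33-5\sqrt{41})/16$ and $\tau_0:=4/\sqrt{41}$. For each $n$ and $r$ let $\mathbf C_{r,n}$ be a random covariance matrix of size $r\times r$. Assume that for all $0<\bar\rho<2\rho_0$, the largest eigenvalue $\lambda_1$ and the smallest eigenvalue $\lambda_r$ of $\mathbf C_{r,n}$, where $r:=\lfloor\bar\rho n\rfloor$, satisfy for all $n\ge n_0(\bar\rho)$ $$\forall\,0\le t<\tau_0,\quad \mathbb P\Big\{\big(\lambda_1-(1+\sqrt{\bar\rho})^2\big)\vee\big((1-\sqrt{\bar\rho})^2-\lambda_r\big)\ge t\Big\}\le c(\bar\rho)\,e^{-n\mathbb W(\bar\rho,t)},$$ where $n_0(\bar\rho)\ge2$ and $c(\bar\rho)>0$ may both depend on $\bar\rho$, and the function $t\mapsto\mathbb W(\bar\rho,t)$ is continuous and (strictly) increasing on $[0,\tau_0)$ with $\mathbb W(\bar\rho,0)=0$. (1) Let $0<\delta<1$ and $0<\rho<\rho_0$ be such that $$\delta>\frac1{2\rho}\exp\Big\{1-\frac1{2\rho}\,\mathbb W\Big[2\rho,\;2\tau_0(\sqrt\rho-\sqrt{\rho_0})\Big(\sqrt\rho-\frac1{2\sqrt{\rho_0}}\Big)\Big]\Big\}.$$ Then for any sequence $(\mathbf M^{(n)})_{n\ge2}$ of random $n\times p$ matrices ($p=p(n)$) with $n/p\to\delta$ satisfying the covariance model (defined in the context) with the family $(\mathbf C_{r,n})$, there is $D_1(\delta,\rho)>0$ (which may depend on $\delta$ and $\rho$) such that for all sufficiently large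 $n$ $$\mathbb P\Big\{\text{for all integers }1\le s\le s_0=\lfloor\rho n\rfloor:\ \frac{1+\mathfrak c_{\max}(2s,\mathbf M^{(n)})}{1-\mathfrak c_{\min}(2s,\mathbf M^{(n)})}<\frac{(4+\sqrt{41})^2}{25}\Big\}\ \ge\ 1-2c(2\rho)e^{-nD_1(\delta,\rho)},$$ and hence this probability tends to $1$. (2) Furthermore, for all $\varepsilon>0$ and for all $0<\bar\rho<2\rho_0$ and $0<\delta<1$ such that $\delta^{-1}\mathbf H_e(\bar\rho\delta)$ belongs to the range of $\mathbb W(\bar\rho,\cdot)$, and for any such sequence $(\mathbf M^{(n)})$ (covariance model, $n/p\to\delta$), there is $D_2(\bar\rho,\delta,\varepsilon)>0$ such that for all sufficiently large $n$ $$\mathbb P\Big\{\mathfrak c_{\min}(\lfloor\bar\rho n\rfloor,\mathbf M^{(n)})\ge\sqrt{\bar\rho}\,(2-\sqrt{\bar\rho})+t_0+\varepsilon\Big\}\le c(\bar\rho)e^{-nD_2(\bar\rho,\delta,\varepsilon)},$$ $$\mathbb P\Big\{\mathfrak c_{\max}(\lfloor\bar\rho n\rfloor,\mathbf M^{(n)})\ge\sqrt{\bar\rho}\,(2+\sqrt{\bar\rho})+t_0+\varepsilon\Big\}\le c(\bar\rho)e^{-nD_2(\bar\rho,\delta,\varepsilon)},$$ where $t_0:=\mathbb W^{-1}\big(\bar\rho,\delta^{-1}\mathbf H_e(\bar\rho\delta)\big)$.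
   Context: $\mathbf H_e(t):=-t\log t-(1-t)\log(1-t)$ for $t\in(0,1)$ (natural logarithm). $\mathbb W^{-1}(\bar\rho,\cdot)$ denotes the inverse of $t\mapsto\mathbb W(\bar\rho,t)$ on its range. $a\vee b=\max(a,b)$. Covariance model: for $R\subseteq\{1,\dots,p\}$, $\mathbf M_R$ is the $n\times|R|$ matrix formed by the columns of $\mathbf M$ indexed by $R$, and $\mathbf M_R^\star$ its adjoint. A random $n\times p$ matrix $\mathbf M$ satisfies the covariance model if for every $r\in\{1,\dots,\lceil2\rho_0n\rceil\}$ and every $R\subseteq\{1,\dots,p\}$ with $|R|=r$, the matrix $\mathbf M_R^\star\mathbf M_R$ has the same law as $\mathbf C_{r,n}$. (No independence of entries or columns is assumed.) Restricted isometry constants: with $\Sigma_s\subset\mathbb R^p$ the set of vectors with at most $s$ nonzero coordinates, $\mathfrak c_{\min}(s,\mathbf M)$ is the smallest $c_-\ge0$ such that $(1-c_-)\|x\|_2^2\le\|\mathbf Mx\|_2^2$ for all $x\in\Sigma_s$, and $\mathfrak c_{\max}(s,\mathbf M)$ is the smallest $c_+\ge0$ such that $(1+c_+)\|x\|_2^2\ge\|\mathbf Mx\|_2^2$ for all $x\in\Sigma_s$. The ratio $(1+\mathfrak c_{\max})/(1-\mathfrak c_{\min})$ is understood to be $+\infty$ when $\mathfrak c_{\min}=1$. *)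

(* Defs.v *)
(* MathComp-Analysis *)
From HB Require Import structures.
From mathcomp Require Import all_boot all_order all_algebra.
From mathcomp Require Import all_classical all_reals all_analysis.

Set Implicit Arguments.
Unset Strict Implicit.
Unset Printing Implicit Defensive.

Import Order.TTheory GRing.Theory Num.Theory.
Import numFieldNormedType.Exports.

Local Open Scope classical_set_scope.
Local Open Scope ring_scope.

Section MatrixSigmaAlgebra.
Context (R : realType) (m n : nat).

Definition mx_entry (ij : 'I_m * 'I_n) (A : 'M[R]_(m, n)) : R := A ij.1 ij.2.

(* Sigma-algebra generated by the entries, i.e. the Borel sigma-algebra of
   R^(m * n). *)
Definition mx_sigma : set (set 'M[R]_(m, n)) :=
  <<s \bigcup_ij preimage_set_system setT (mx_entry ij) measurable >>.

Let mx_sigma0 : mx_sigma set0.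
Proof. exact: sigma_algebra0. Qed.

Let mx_sigmaC A : mx_sigma A -> mx_sigma (~` A).
Proof. exact: sigma_algebraC. Qed.

Let mx_sigma_bigcup (F : (set 'M[R]_(m, n))^nat) :
  (forall i, mx_sigma (F i)) -> mx_sigma (\bigcup_i F i).
Proof. exact: sigma_algebra_bigcup. Qed.

HB.instance Definition _ := @isMeasurable.Build default_measure_display
  'M[R]_(m, n) mx_sigma mx_sigma0 mx_sigmaC mx_sigma_bigcup.

End MatrixSigmaAlgebra.

Section Definitions.
Context (R : realType).

Definition rho0 : R := (33 - 5 * Num.sqrt 41) / 16.

Definition tau0 : R := 4 / Num.sqrt 41.

Definition entropy (t : R) : R := - t * ln t - (1 - t) * ln (1 - t).

(* Inverse on its range of the restriction of w to [0, tau0). *)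
Definition rate_inv (w : R -> R) : R -> R :=
  'pinv_(fun=> 0) `[0, tau0[%classic w.

Definition covariance_mx r (A : 'M[R]_r) : Prop :=
  A^T = A /\ forall x : 'cV[R]_r, 0 <= (x^T *m A *m x) 0 0.

(* Extreme eigenvalues; only meaningful for symmetric A with 0 < r. *)
Definition lambda_max r (A : 'M[R]_r) : R := sup [set a | eigenvalue A a].

Definition lambda_min r (A : 'M[R]_r) : R := inf [set a | eigenvalue A a].

Definition norm2 n (x : 'cV[R]_n) : R := Num.sqrt (\sum_i x i 0 ^+ 2).

Definition sparse p (s : nat) : set 'cV[R]_p :=
  [set x | (#|[pred i | x i 0%R != 0%R]| <= s)%N].

Definition cmin n p (s : nat) (M : 'M[R]_(n, p)) : R :=
  inf [set c | 0 <= c /\ forall x, sparse s x ->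
    (1 - c) * norm2 x ^+ 2 <= norm2 (M *m x) ^+ 2].

Definition cmax n p (s : nat) (M : 'M[R]_(n, p)) : R :=
  inf [set c | 0 <= c /\ forall x, sparse s x ->
    (1 + c) * norm2 x ^+ 2 >= norm2 (M *m x) ^+ 2].

Definition ric_ratio n p (s : nat) (M : 'M[R]_(n, p)) : \bar R :=
  if cmin s M == 1 then +oo%E
  else ((1 + cmax s M) / (1 - cmin s M))%:E.

(* M_A : the columns of M indexed by A, in increasing order. *)
Definition cols n p (A : {set 'I_p}) (M : 'M[R]_(n, p)) : 'M[R]_(n, #|A|) :=
  colsub (fun j : 'I_#|A| => enum_val j) M.

Definition same_law d1 d2 d (T1 : measurableType d1) (T2 : measurableType d2)
    (T : measurableType d) (P1 : probability T1 R) (P2 : probability T2 R)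
    (X1 : T1 -> T) (X2 : T2 -> T) : Prop :=
  forall B : set T, measurable B -> P1 (X1 @^-1` B) = P2 (X2 @^-1` B).

Definition covariance_model
    (dC : nat -> nat -> measure_display)
    (TC : forall r n, measurableType (dC r n))
    (PC : forall r n, probability (TC r n) R)
    (C : forall r n, TC r n -> 'M[R]_r)
    d (T : measurableType d) (P : probability T R)
    (n p : nat) (M : T -> 'M[R]_(n, p)) : Prop :=
  forall r : nat, (0 < r)%N -> r%:Z <= Num.ceil (2 * rho0 * n%:R) ->
  forall A : {set 'I_p}, #|A| = r ->
    same_law P (PC #|A| n)
      (fun w => (cols A (M w))^T *m cols A (M w)) (C #|A| n).

End Definitions.

Arguments rho0 {R}.
Arguments tau0 {R}.

(* Main.v *)
Require Import Defs.
From mathcomp Require Import all_boot all_order all_algebra.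
From mathcomp Require Import all_classical all_reals all_analysis.
From mathcomp Require Import measurable_realfun ring lra.
Import Order.TTheory GRing.Theory Num.Theory.
Import numFieldNormedType.Exports.
Local Open Scope classical_set_scope.
Local Open Scope ring_scope.

(** Only the vectors supported on a set of columns matter for the restricted
isometry constants of order [r], so both constants are governed by the extreme
eigenvalues of the [r]-column Gram matrices of [M], each of which has the law
of [C r n].  If every such Gram matrix has its spectrum strictly between
[(1 - q) ^ 2 - t] and [(1 + q) ^ 2 + t], where [q] is the square root of the
aspect ratio [rb], then [cmin] is below [1 - (1 - q) ^ 2 + t] and [cmax] is below
[(1 + q) ^ 2 + t - 1] ([cmin_lt_of_not_outlying], [cmax_lt_of_not_outlying]).
By the union bound, the exceptional event [gram_deviation] has probability at
most ['C(p, r) * c rb * exp (- n W rb t)].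

Since ['C(p, r) <= u ^ (- r) * (1 - u) ^ (- (p - r))] for every [u] in
[(0, 1)], the choice [u = rb * delta] bounds the binomial coefficient by
[exp (n v)] for large [n], for any [v] above [H (rb * delta) / delta]
([near_binomial_le]).  Hence the exceptional event is exponentially unlikely
as soon as [W rb t > H (rb * delta) / delta] ([near_gram_deviation]).

For the bounds on the constants, [t] is taken slightly above [t0], and the
monotonicity of [W rb] provides the strict inequality.  For the ratio, [t] is
the value at which [(1 + q) ^ 2 + t = K * ((1 - q) ^ 2 - t)] with
[K = (4 + sqrt 41) ^ 2 / 25]; since [(K - 1) / (K + 1) = tau0], it is
[tau0 * (1 + q ^ 2) - 2 * q], whose roots in [sqrt rho] are [sqrt rho0] and
[1 / (2 * sqrt rho0)]: this is the factorization that the hypothesis on [delta]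
displays ([threshold_eq], [ratio_bound_identity]).  That hypothesis says
[W rb t > rb * (1 - ln (rb * delta))], and the right-hand side dominates
[H (rb * delta) / delta] ([entropy_le]).

Two facts about quadratic forms support the argument.  Eigenvalue bounds for a
symmetric matrix are bounds on its form ([lambda_max_le], [lambda_min_ge]), which carries
them to sparse vectors.  A sign condition on a quadratic form need only be
tested on integer vectors ([qform_ge0_int]), which makes every event above
measurable, as the transfer of laws and the union bound require. *)

Set Implicit Arguments.
Unset Strict Implicit.
Unset Printing Implicit Defensive.

(** * Quadratic forms and extreme eigenvalues *)

Section QuadraticForms.
Context {R : realType}.
Implicit Types (n : nat).

Definition qform n (A : 'M[R]_n) (x : 'cV[R]_n) : R := (x^T *m A *m x) 0 0.

Lemma norm2_sqr n (x : 'cV[R]_n) : norm2 x ^+ 2 = \sum_i x i 0 ^+ 2.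
Proof. by rewrite /norm2 sqr_sqrtr// sumr_ge0// => i _; rewrite sqr_ge0. Qed.

Lemma norm2_sqr_dot n (x : 'cV[R]_n) : norm2 x ^+ 2 = (x^T *m x) 0 0.
Proof. by rewrite norm2_sqr mxE; apply: eq_bigr => i _; rewrite mxE expr2. Qed.

Lemma norm2_sqr_gt0 n (x : 'cV[R]_n) : x != 0 -> 0 < norm2 x ^+ 2.
Proof.
move=> x0; rewrite lt_neqAle sqr_ge0 andbT eq_sym; apply: contra x0.
rewrite norm2_sqr psumr_eq0 => [/allP h|i _]; last exact: sqr_ge0.
apply/eqP/matrixP => i j; rewrite ord1 mxE; apply/eqP.
by rewrite -sqrf_eq0; apply: h; rewrite mem_index_enum.
Qed.

Lemma qformD n (A B : 'M[R]_n) x : qform A x + qform B x = qform (A + B) x.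
Proof. by rewrite /qform mulmxDr mulmxDl [RHS]mxE. Qed.

Lemma qformN n (A : 'M[R]_n) x : qform (- A) x = - qform A x.
Proof. by rewrite /qform mulmxN mulNmx [LHS]mxE. Qed.

Lemma qformB n (A B : 'M[R]_n) x : qform A x - qform B x = qform (A - B) x.
Proof. by rewrite -qformN qformD. Qed.

Lemma qform_scalar n (a : R) (x : 'cV[R]_n) : qform a%:M x = a * norm2 x ^+ 2.
Proof. by rewrite /qform mul_mx_scalar -scalemxAl mxE norm2_sqr_dot. Qed.

Lemma qform_gram m n (M : 'M[R]_(m, n)) x :
  qform (M^T *m M) x = norm2 (M *m x) ^+ 2.
Proof. by rewrite norm2_sqr_dot trmx_mul /qform !mulmxA. Qed.

Lemma qformE n (A : 'M[R]_n) x :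
  qform A x = \sum_i \sum_j x j 0 * A j i * x i 0.
Proof.
rewrite /qform mxE; apply: eq_bigr => i _; rewrite mxE mulr_suml.
by apply: eq_bigr => j _; rewrite mxE.
Qed.

Lemma qformZ n (A : 'M[R]_n) (a : R) x : qform A (a *: x) = a ^+ 2 * qform A x.
Proof.
rewrite !qformE mulr_sumr; apply: eq_bigr => i _; rewrite mulr_sumr.
by apply: eq_bigr => j _; rewrite !mxE; ring.
Qed.

Lemma coord_le_norm2 n (x : 'cV[R]_n) i : `|x i 0| <= norm2 x.
Proof.
rewrite -ler_sqr ?nnegrE ?sqrtr_ge0// norm2_sqr (bigD1 i)//= real_normK ?num_real//.
by rewrite lerDl sumr_ge0// => j _; exact: sqr_ge0.
Qed.

Lemma mulmx_bounded m n (M : 'M[R]_(m, n)) :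
  exists2 L : R, 0 < L & forall x, norm2 (M *m x) ^+ 2 <= L * norm2 x ^+ 2.
Proof.
exists (1 + \sum_i (\sum_j `|M i j|) ^+ 2) => [|x].
  by rewrite ltr_wpDr// sumr_ge0// => i _; exact: sqr_ge0.
rewrite mulrDl mul1r ler_wpDl ?sqr_ge0// norm2_sqr mulr_suml.
apply: ler_sum => i _; rewrite -exprMn -[_ ^+ 2]real_normK ?num_real//.
rewrite lerXn2r ?nnegrE ?mulr_ge0 ?sqrtr_ge0 ?sumr_ge0// mxE.
rewrite (le_trans (ler_norm_sum _ _ _))// mulr_suml.
by apply: ler_sum => j _; rewrite normrM ler_wpM2l// coord_le_norm2.
Qed.

Lemma qform_bounded n (A : 'M[R]_n) :
  exists2 L : R, 0 < L & forall x, qform A x <= L * norm2 x ^+ 2.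
Proof.
exists (1 + \sum_i \sum_j `|A j i|) => [|x].
  by rewrite ltr_wpDr// sumr_ge0// => i _; rewrite sumr_ge0.
rewrite mulrDl mul1r ler_wpDl ?sqr_ge0// qformE mulr_suml.
apply: ler_sum => i _; rewrite mulr_suml; apply: ler_sum => j _.
rewrite (le_trans (ler_norm _))// !normrM mulrAC [X in X <= _]mulrC expr2.
by rewrite ler_wpM2l// ler_pM// coord_le_norm2.
Qed.

(** The operator inequality [B ^ 2 <= L * B] for [0 <= B <= L], without the
spectral theorem: expand the form at the vector [L *: x - B *m x]. *)
Lemma psd_norm2_mulmx n (B : 'M[R]_n) (L : R) : B^T = B -> 0 < L ->
  (forall x, 0 <= qform B x <= L * norm2 x ^+ 2) ->
  forall x, norm2 (B *m x) ^+ 2 <= L * qform B x.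
Proof.
move=> symB L0 hB x; set y := B *m x.
have qLxy : qform B (L *: x - y) =
    L ^+ 2 * qform B x - 2 * L * norm2 y ^+ 2 + qform B y.
  have xBy : x^T *m B *m y = y^T *m y by rewrite [in RHS]/y trmx_mul symB.
  have yBx : y^T *m B *m x = y^T *m y by rewrite -mulmxA.
  rewrite /qform [(_ - y)^T]linearB linearZ/= !mulmxBl !mulmxBr -!scalemxAl.
  rewrite -!scalemxAr xBy yBx norm2_sqr_dot !mxE.
  ring.
have /andP[+ _] := hB (L *: x - y); rewrite qLxy => h1.
have /andP[_ h2] := hB y.
have : 0 <= L * (L * qform B x - norm2 y ^+ 2) by lra.
by rewrite pmulr_rge0// subr_ge0.
Qed.

(** The extremal constants of this development are infima of such sets; being
closed and upward closed is what makes the infimum admissible itself. *)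
Lemma inf_mem_closed_up (S : set R) : has_inf S ->
  (forall a b, a <= b -> S a -> S b) ->
  (forall a, (forall e, 0 < e -> S (a + e)) -> S a) -> S (inf S).
Proof.
move=> hS up cl; apply: cl => e e0.
by have [a Sa /ltW] := inf_adherent e0 hS; move=> /up; apply.
Qed.

(** Let [mu] be the least constant with [A <= mu] as forms.  If [B = mu - A] were
invertible, then [norm2 x ^+ 2 <= L' * norm2 (B *m x) ^+ 2 <= L' * L * qform B x],
so [B] would dominate a positive multiple of the identity and [mu] could be
lowered.  Hence [B] is singular and [mu] is an eigenvalue. *)
Lemma sym_top_eigenvalue n (A : 'M[R]_n) : (0 < n)%N -> A^T = A ->
  exists2 mu, eigenvalue A mu & forall x, qform A x <= mu * norm2 x ^+ 2.
Proof.
case: n A => // n A _ symA.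
pose S := [set m | forall x, qform A x <= m * norm2 x ^+ 2].
have upS a b : a <= b -> S a -> S b.
  by move=> ab Sa x; rewrite (le_trans (Sa x))// ler_wpM2r// sqr_ge0.
have infS : has_inf S.
  split; first by have [L _ hL] := qform_bounded A; exists L.
  have e0 : (const_mx 1 : 'cV[R]_n.+1) != 0.
    by apply/eqP => /matrixP/(_ 0 0); rewrite !mxE => /eqP; rewrite oner_eq0.
  exists (qform A (const_mx 1) / norm2 (const_mx 1 : 'cV[R]_n.+1) ^+ 2) => a Sa.
  by rewrite ler_pdivrMr ?norm2_sqr_gt0//; exact: Sa.
have Smu : S (inf S).
  apply: inf_mem_closed_up => // a Sa x; apply/ler_addgt0Pr => e e0.
  have [->|x0] := eqVneq x 0.
    have := Sa 1 ltr01 0; rewrite !norm2_sqr_dot !mulmx0 mxE !mulr0 => h.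
    by rewrite add0r (le_trans h) ?ltW.
  have /norm2_sqr_gt0 h := x0.
  have := Sa _ (divr_gt0 e0 h) x.
  by rewrite mulrDl divfK ?gt_eqF.
set mu := inf S in Smu.
exists mu => //; pose B := mu%:M - A.
have symB : B^T = B by rewrite linearB/= tr_scalar_mx symA.
have qB x : qform B x = mu * norm2 x ^+ 2 - qform A x by rewrite -qformB qform_scalar.
have [L L0 hL] := qform_bounded B.
have psdB x : 0 <= qform B x <= L * norm2 x ^+ 2.
  by rewrite hL andbT qB subr_ge0; exact: Smu.
have [Bu|] := boolP (B \in unitmx); last first.
  rewrite unitmxE unitfE negbK => /det0P[v v0 vB].
  apply/eigenvalueP; exists v => //; apply/eqP; rewrite eq_sym -subr_eq0.
  by rewrite -mul_mx_scalar -mulmxBr vB.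
have [L' L'0 hL'] := mulmx_bounded (invmx B).
have : S (mu - (L' * L)^-1).
  move=> x; have := hL' (B *m x); rewrite mulKmx// => h1.
  have h2 := psd_norm2_mulmx symB L0 psdB x.
  have : norm2 x ^+ 2 <= (L' * L) * qform B x.
    by rewrite (le_trans h1)// -mulrA ler_wpM2l// ltW.
  rewrite -ler_pdivrMl ?mulr_gt0// qB => h3; lra.
move=> /(ge_inf infS.2) /=; rewrite -/mu => h.
have : 0 < (L' * L)^-1 by rewrite invr_gt0 mulr_gt0.
lra.
Qed.

Lemma eigenvalue_qform n (A : 'M[R]_n) a : A^T = A -> eigenvalue A a ->
  exists2 x, x != 0 & qform A x = a * norm2 x ^+ 2.
Proof.
move=> symA /eigenvalueP[v vA v0]; exists v^T; first by rewrite trmx_eq0.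
by rewrite /qform trmxK vA -scalemxAl mxE norm2_sqr_dot trmxK.
Qed.

Lemma lambda_max_le n (A : 'M[R]_n) s : (0 < n)%N -> A^T = A ->
  (lambda_max A <= s) <-> (forall x, qform A x <= s * norm2 x ^+ 2).
Proof.
move=> n0 symA; have [mu eig hmu] := sym_top_eigenvalue n0 symA.
have ub s' : (forall x, qform A x <= s' * norm2 x ^+ 2) ->
    ubound [set a | eigenvalue A a] s'.
  move=> h a /= /(eigenvalue_qform symA)[x x0 xa].
  by have := h x; rewrite xa ler_pM2r// norm2_sqr_gt0.
split=> [h x|h].
  rewrite (le_trans (hmu x))// ler_wpM2r ?sqr_ge0//; apply: le_trans h.
  by apply: ub_le_sup => //; exists mu; exact: ub.
by apply: ge_sup; [exists mu|exact: ub].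
Qed.

Lemma eigenvalueN n (A : 'M[R]_n) a : eigenvalue (- A) a = eigenvalue A (- a).
Proof.
apply/eigenvalueP/eigenvalueP => -[v vA v0]; exists v => //.
  by rewrite scaleNr -vA mulmxN opprK.
by rewrite mulmxN vA scaleNr opprK.
Qed.

Lemma lambda_min_ge n (A : 'M[R]_n) s : (0 < n)%N -> A^T = A ->
  (s <= lambda_min A) <-> (forall x, s * norm2 x ^+ 2 <= qform A x).
Proof.
move=> n0 symA.
have -> : lambda_min A = - lambda_max (- A).
  rewrite /lambda_min /lambda_max /inf; congr (- sup _).
  apply/seteqP; split=> [_ [a /= ha <-]|a /= ha]; first by rewrite /= eigenvalueN opprK.
  by exists (- a); rewrite ?opprK//= -eigenvalueN.
rewrite lerNr lambda_max_le ?linearN/= ?symA//.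
by split=> h x; have := h x; rewrite qformN mulNr lerN2.
Qed.

End QuadraticForms.

(** * Measurability of sign conditions on quadratic forms *)

Section Measurability.
Context {R : realType}.

Lemma floor_approx_cvg (a : R) :
  (k.+1%:R^-1 * (Num.floor (k.+1%:R * a))%:~R : R) @[k --> \oo] --> a.
Proof.
apply: (@squeeze_cvgr _ _ _ _ (fun k => a - harmonic k) (cst a)).
- apply: nearW => k /=; have k0 : 0 < k.+1%:R :> R by rewrite ltr0n.
  have /andP[h1 h2] := floor_itv (k.+1%:R * a).
  rewrite ler_pdivrMl// h1 andbT ler_pdivlMl// mulrBr mulfV ?gt_eqF//.
  by rewrite lerBlDr ltW// -[1]/(1%:~R) -intrD.
- rewrite -[X in _ --> X]subr0; apply: cvgB; [exact: cvg_cst|exact: cvg_harmonic].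
- exact: cvg_cst.
Qed.

Lemma qform_cvg n (B : 'M[R]_n) (u : nat -> 'cV[R]_n) (x : 'cV[R]_n) :
  (forall i, u k i 0 @[k --> \oo] --> x i 0) ->
  qform B (u k) @[k --> \oo] --> qform B x.
Proof.
move=> ux; rewrite qformE; under eq_fun do rewrite qformE.
apply: cvg_big => [|i _]; first exact: add_continuous.
apply: cvg_big => [|j _]; first exact: add_continuous.
by apply: cvgM => //; apply: cvgM => //; exact: cvg_cst.
Qed.

(** By homogeneity the form is nonnegative at [floor (k x) / k], which tends to
[x]; rounding down keeps zero coordinates at zero, so sparsity is preserved. *)
Lemma qform_ge0_int n (B : 'M[R]_n) s :
  (forall z : 'cV[int]_n, sparse s (map_mx intr z : 'cV[R]_n) ->
     0 <= qform B (map_mx intr z)) ->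
  forall x : 'cV[R]_n, sparse s x -> 0 <= qform B x.
Proof.
move=> hB x sx.
pose z k : 'cV[int]_n := map_mx (fun a => Num.floor (k.+1%:R * a)) x.
pose u k : 'cV[R]_n := k.+1%:R^-1 *: map_mx intr (z k).
have /cvgr_to_ge : qform B (u k) @[k --> \oo] --> qform B x.
  apply: qform_cvg => i; under eq_fun do rewrite !mxE.
  exact: floor_approx_cvg.
apply; apply: nearW => k; rewrite qformZ mulr_ge0 ?sqr_ge0//; apply: hB.
apply: leq_trans sx; apply/subset_leq_card/fintype.subsetP => i.
by rewrite !inE !mxE; apply: contra => /eqP ->; rewrite mulr0 floor0.
Qed.

Lemma measurable_forall_count d (T : measurableType d) (I : countType)
    (F : I -> set T) :
  (forall i, measurable (F i)) -> measurable [set w | forall i, F i w].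
Proof.
move=> mF; rewrite (_ : [set _ | _] =
    \bigcap_k (if unpickle k is Some i then F i else setT)); last first.
  apply/seteqP; split=> [w h k _|w h i]; first by case: unpickle.
  by have := h (pickle i) Logic.I; rewrite pickleK.
by apply: bigcapT_measurable => k; case: unpickle => // ; exact: mF.
Qed.

Lemma measurable_qform_ge0 d (T : measurableType d) n (F : T -> 'M[R]_n) s :
  (forall i j, measurable_fun setT (fun w => F w i j)) ->
  measurable [set w | forall x, sparse s x -> 0 <= qform (F w) x].
Proof.
move=> mF; rewrite (_ : [set _ | _] = [set w | forall z : 'cV[int]_n,
    [set w | sparse s (map_mx intr z : 'cV[R]_n) ->
             0 <= qform (F w) (map_mx intr z)] w]); last first.
  by apply/seteqP; split=> w /= h; [move=> z; exact: h|exact: qform_ge0_int].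
apply: measurable_forall_count => z.
have [sz|nsz] := pselect (sparse s (map_mx intr z : 'cV[R]_n)); last first.
  rewrite (_ : [set _ | _] = setT); first exact: measurableT.
  by apply/seteqP; split=> w //= _ /nsz.
rewrite (_ : [set _ | _] = setT `&` [set w | 0 <= qform (F w) (map_mx intr z)]).
  apply: measurable_fun_le => //; under eq_fun do rewrite qformE.
  apply: measurable_sum => i; apply: measurable_sum => j.
  by apply: measurable_funM => //; exact: measurable_funM.
by rewrite setTI; apply/seteqP; split=> w /= => [/(_ sz)|].
Qed.

Lemma measurable_mx_entry m n (i : 'I_m) (j : 'I_n) :
  measurable_fun setT (fun A : 'M[R]_(m, n) => A i j).
Proof.
move=> _ Y mY; rewrite setTI; apply: sub_sigma_algebra.
by exists (i, j) => //; exists Y => //; rewrite setTI.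
Qed.

Lemma measurable_entry d (T : measurableType d) m n (M : T -> 'M[R]_(m, n)) :
  measurable_fun setT M -> forall i j, measurable_fun setT (fun w => M w i j).
Proof. by move=> mM i j; exact: (measurableT_comp (measurable_mx_entry i j) mM). Qed.

Lemma measurable_gram_entry d (T : measurableType d) m n (M : T -> 'M[R]_(m, n)) :
  (forall i j, measurable_fun setT (fun w => M w i j)) ->
  forall i j, measurable_fun setT (fun w => ((M w)^T *m M w) i j).
Proof.
move=> mM i j; under eq_fun do rewrite mxE.
apply: measurable_sum => k; under eq_fun do rewrite mxE.
exact: measurable_funM.
Qed.

End Measurability.

(** * Spectral bands of symmetric matrices *)

Section Outlying.
Context {R : realType}.

Definition form_within n (l u : R) (A : 'M[R]_n) :=
  forall x, l * norm2 x ^+ 2 <= qform A x <= u * norm2 x ^+ 2.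

Lemma form_withinP n l u (A : 'M[R]_n) : form_within l u A <->
  (forall x, 0 <= qform (A - l%:M) x) /\ (forall x, 0 <= qform (u%:M - A) x).
Proof.
split=> [h|[h1 h2] x].
  by split=> x; rewrite -qformB qform_scalar subr_ge0; have /andP[] := h x.
apply/andP; split.
  by have := h1 x; rewrite -qformB qform_scalar subr_ge0.
by have := h2 x; rewrite -qformB qform_scalar subr_ge0.
Qed.

Lemma form_withinS n l l' u u' (A : 'M[R]_n) : l' <= l -> u <= u' ->
  form_within l u A -> form_within l' u' A.
Proof.
move=> ll uu h x; have /andP[h1 h2] := h x; apply/andP; split.
  by apply: le_trans h1; rewrite ler_wpM2r// sqr_ge0.
by apply: le_trans h2 _; rewrite ler_wpM2r// sqr_ge0.
Qed.

(** For a symmetric matrix of positive size: some eigenvalue lies outside the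
open interval from [l] to [u].  The countable family of nested bands, in place
of strict inequalities at each vector, keeps a uniform margin and makes the set
measurable on all matrices, symmetric or not. *)
Definition outlying n (l u : R) : set 'M[R]_n :=
  [set A | forall k : nat, ~ form_within (l + k.+1%:R^-1) (u - k.+1%:R^-1) A].

Lemma outlying_lambda n a b t (A : 'M[R]_n) : (0 < n)%N -> A^T = A ->
  outlying (b - t) (a + t) A <->
  t <= Num.max (lambda_max A - a) (b - lambda_min A).
Proof.
move=> n0 symA.
have withinE l u : form_within l u A <-> l <= lambda_min A /\ lambda_max A <= u.
  rewrite lambda_min_ge// lambda_max_le//; split=> [h|[h1 h2] x].
    by split=> x; have /andP[] := h x.
  by rewrite h1 h2.
split=> [h|h k /withinE[h1 h2]].
  rewrite leNgt; apply/negP; rewrite gt_max => /andP[h1 h2].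
  have : 0 < Num.min (a + t - lambda_max A) (lambda_min A - (b - t)).
    by rewrite lt_min !subr_gt0 -ltrBlDl h1 ltrBlDl -ltrBlDr h2.
  move=> /ltr_add_invr[k]; rewrite add0r lt_min => /andP[k1 k2].
  by apply: (h k); apply/withinE; move: (k.+1%:R^-1) k1 k2 => e k1 k2; split; lra.
have k0 : 0 < k.+1%:R^-1 :> R by rewrite invr_gt0 ltr0n.
by move: (k.+1%:R^-1) k0 h1 h2 h {symA withinE} => e e0 h1 h2; rewrite le_max => /orP[] h; lra.
Qed.

Lemma sparse_full n (x : 'cV[R]_n) : sparse n x.
Proof. by rewrite /sparse/= (leq_trans (max_card _))// card_ord. Qed.

Lemma measurable_ge_scalar d (T : measurableType d) n s c (F : T -> 'M[R]_n) :
  (forall i j, measurable_fun setT (fun w => F w i j)) ->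
  measurable [set w | forall x, sparse s x -> 0 <= qform (F w - c%:M) x].
Proof.
move=> mF; apply: measurable_qform_ge0 => i j.
under eq_fun do rewrite mxE [X in _ + X]mxE.
by apply: measurable_funB => //; exact: measurable_cst.
Qed.

Lemma measurable_le_scalar d (T : measurableType d) n s c (F : T -> 'M[R]_n) :
  (forall i j, measurable_fun setT (fun w => F w i j)) ->
  measurable [set w | forall x, sparse s x -> 0 <= qform (c%:M - F w) x].
Proof.
move=> mF; apply: measurable_qform_ge0 => i j.
under eq_fun do rewrite mxE [X in _ + X]mxE.
by apply: measurable_funB => //; exact: measurable_cst.
Qed.

Lemma measurable_outlying d (T : measurableType d) n l u (F : T -> 'M[R]_n) :
  (forall i j, measurable_fun setT (fun w => F w i j)) ->
  measurable [set w | outlying l u (F w)].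
Proof.
move=> mF; pose within k := [set w | form_within (l + k.+1%:R^-1) (u - k.+1%:R^-1) (F w)].
apply: (@measurable_forall_count _ _ nat (fun k => ~` within k)) => k.
apply: measurableC; rewrite (_ : within k =
  [set w | forall x, sparse n x -> 0 <= qform (F w - (l + k.+1%:R^-1)%:M) x] `&`
  [set w | forall x, sparse n x -> 0 <= qform ((u - k.+1%:R^-1)%:M - F w) x]).
  by apply: measurableI; [exact: measurable_ge_scalar|exact: measurable_le_scalar].
apply/seteqP; split=> w /=.
  by move=> /form_withinP[h1 h2]; split.
by move=> [h1 h2]; apply/form_withinP; split=> x; [apply: h1|apply: h2];
  exact: sparse_full.
Qed.

End Outlying.

(** * Restricted isometry constants *)

Lemma ex_superset_card (T : finType) (S : {set T}) k :
  (#|S| <= k <= #|T|)%N -> exists2 A : {set T}, S \subset A & #|A| = k.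
Proof.
elim: k => [|k IH] /andP[Sk kT].
  by exists S => //; apply/eqP; rewrite -leqn0.
move: Sk; rewrite leq_eqVlt => /orP[/eqP Sk|]; first by exists S.
rewrite ltnS => Sk; have [|A SA Ak] := IH; first by rewrite Sk ltnW.
have /card_gt0P[y] : (0 < #|~: A|)%N by rewrite -(ltn_add2l #|A|) cardsC addn0 Ak.
rewrite inE => yA; exists (y |: A); last by rewrite cardsU1 yA Ak.
by rewrite (fintype.subset_trans SA)// finset.subsetUr.
Qed.

Section RestrictedIsometry.
Context {R : realType} (n p : nat).
Implicit Types (M : 'M[R]_(n, p)) (A : {set 'I_p}) (x : 'cV[R]_p).

Lemma cols_mulmx M A x : (forall i, x i 0 != 0 -> i \in A) ->
  exists y : 'cV[R]_#|A|, cols A M *m y = M *m x /\ norm2 y = norm2 x.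
Proof.
move=> xA; exists (\col_j x (enum_val j) 0).
have restrict F : (forall i, x i 0 = 0 -> F i = 0) ->
    \sum_i F i = \sum_(j < #|A|) F (enum_val j) :> R.
  move=> F0; rewrite -big_enum_val [RHS]big_mkcond/=; apply: eq_bigr => i _.
  by case: ifPn => // iA; rewrite F0//; apply/eqP; apply: contraNT iA; exact: xA.
split.
  apply/matrixP => i k; rewrite ord1 !mxE restrict => [|j ->]; last by rewrite mulr0.
  by apply: eq_bigr => j _; rewrite !mxE.
rewrite /norm2 [in RHS]restrict => [|j ->]; last by rewrite expr0n.
by congr Num.sqrt; apply: eq_bigr => j _; rewrite !mxE.
Qed.

Lemma cmin_has_inf s M : has_inf [set c | 0 <= c /\ forall x, sparse s x ->
    (1 - c) * norm2 x ^+ 2 <= norm2 (M *m x) ^+ 2].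
Proof.
split; last by exists 0 => c [].
by exists 1; split=> // x _; rewrite subrr mul0r sqr_ge0.
Qed.

Lemma cmax_has_inf s M : has_inf [set c | 0 <= c /\ forall x, sparse s x ->
    (1 + c) * norm2 x ^+ 2 >= norm2 (M *m x) ^+ 2].
Proof.
split; last by exists 0 => c [].
have [L L0 hL] := mulmx_bounded M; exists L; split=> [|x _]; first exact: ltW.
by rewrite mulrDl mul1r (le_trans (hL x))// lerDr sqr_ge0.
Qed.

(** The infimum defining [cmin] is attained, because its constraints are closed
conditions on [c]. *)
Lemma cmin_le s M c : cmin s M <= c <->
  0 <= c /\ forall x, sparse s x -> (1 - c) * norm2 x ^+ 2 <= norm2 (M *m x) ^+ 2.
Proof.
have infS := cmin_has_inf s M.
split=> [|h]; last exact: (ge_inf infS.2).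
set S := [set c | _] in infS.
have up a b : a <= b -> S a -> S b.
  move=> ab [a0 h]; split=> [|x sx]; first exact: le_trans ab.
  by rewrite (le_trans _ (h x sx))// ler_wpM2r ?sqr_ge0// lerB.
move=> /up; apply; apply: inf_mem_closed_up => // a ha.
split=> [|x sx]; first by apply/ler_addgt0Pr => e /ha[].
apply/ler_addgt0Pr => e e0; have [->|x0] := eqVneq x 0.
  by rewrite norm2_sqr_dot mulmx0 mxE mulr0 addr_ge0 ?sqr_ge0// ltW.
have /norm2_sqr_gt0 h := x0; have [_ /(_ x sx)] := ha _ (divr_gt0 e0 h).
by rewrite opprD addrA mulrBl divfK ?gt_eqF// lerBlDr.
Qed.

Lemma cmax_le s M c : cmax s M <= c <->
  0 <= c /\ forall x, sparse s x -> norm2 (M *m x) ^+ 2 <= (1 + c) * norm2 x ^+ 2.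
Proof.
have infS := cmax_has_inf s M.
split=> [|h]; last exact: (ge_inf infS.2).
set S := [set c | _] in infS.
have up a b : a <= b -> S a -> S b.
  move=> ab [a0 h]; split=> [|x sx]; first exact: le_trans ab.
  by rewrite (le_trans (h x sx))// ler_wpM2r ?sqr_ge0// lerD.
move=> /up; apply; apply: inf_mem_closed_up => // a ha.
split=> [|x sx]; first by apply/ler_addgt0Pr => e /ha[].
apply/ler_addgt0Pr => e e0; have [->|x0] := eqVneq x 0.
  have [_ /(_ 0)] := ha _ e0; rewrite mulmx0 !norm2_sqr_dot !mulmx0 mxE !mulr0.
  by move=> _; rewrite add0r ltW.
have /norm2_sqr_gt0 h := x0; have [_ /(_ x sx)] := ha _ (divr_gt0 e0 h).
by rewrite addrA mulrDl divfK ?gt_eqF.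
Qed.

Lemma cmin_le1 s M : cmin s M <= 1.
Proof. by apply/cmin_le; split=> // x _; rewrite subrr mul0r sqr_ge0. Qed.

Lemma sparseS s s' x : (s <= s')%N -> sparse s x -> sparse s' x.
Proof. by move=> ss; rewrite /sparse/= => /leq_trans; apply. Qed.

Lemma cminS s s' M : (s <= s')%N -> cmin s M <= cmin s' M.
Proof.
move=> ss; have /cmin_le[c0 h] := lexx (cmin s' M).
by apply/cmin_le; split=> // x sx; apply: h; exact: sparseS sx.
Qed.

Lemma cmaxS s s' M : (s <= s')%N -> cmax s M <= cmax s' M.
Proof.
move=> ss; have /cmax_le[c0 h] := lexx (cmax s' M).
by apply/cmax_le; split=> // x sx; apply: h; exact: sparseS sx.
Qed.

Definition gram A M : 'M[R]_#|A| := (cols A M)^T *m cols A M.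

(** An [r]-sparse vector lives on some set of exactly [r] columns, where the band
of the corresponding Gram matrix applies; there are finitely many such sets, so
a single margin [e] serves all of them. *)
Lemma not_outlying_sparse r l u M : (r <= p)%N ->
  (forall A, #|A| = r -> ~ outlying l u (gram A M)) ->
  exists2 e, 0 < e & forall x, sparse r x ->
    (l + e) * norm2 x ^+ 2 <= norm2 (M *m x) ^+ 2 <= (u - e) * norm2 x ^+ 2.
Proof.
move=> rp h.
have /choice[k hk] : forall A, exists k : nat, #|A| = r ->
    form_within (l + k.+1%:R^-1) (u - k.+1%:R^-1) (gram A M).
  move=> A; have [Ar|Ar] := pselect (#|A| = r); last by exists 0%N.
  have := h _ Ar; rewrite /outlying/= => /existsNP[k /contrapT hk].
  by exists k.
pose K := (\max_A k A)%N; exists K.+1%:R^-1 => [|x sx].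
  by rewrite invr_gt0 ltr0n.
have [|A /fintype.subsetP xA Ar] := @ex_superset_card _ [set i | x i 0 != 0]%SET r.
  by rewrite card_ord rp andbT cardsE.
have [|y [Mxy <-]] := @cols_mulmx M A x; first by move=> i xi; apply: xA; rewrite inE.
have kK : K.+1%:R^-1 <= (k A).+1%:R^-1 :> R.
  by rewrite lef_pV2 ?posrE ?ltr0n// ler_nat ltnS leq_bigmax.
have := hk A Ar; move=> /(@form_withinS _ _ _ (l + K.+1%:R^-1) _ (u - K.+1%:R^-1)).
by rewrite lerD2l lerB// => /(_ kK isT y); rewrite qform_gram Mxy.
Qed.

(** The hypothesis [0 < c] is there because [cmin] is clipped at [0], even when
all Gram eigenvalues exceed [1]. *)
Lemma cmin_lt_of_not_outlying r l u M c : (r <= p)%N -> 0 < c -> 1 - l <= c ->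
  (forall A, #|A| = r -> ~ outlying l u (gram A M)) -> cmin r M < c.
Proof.
move=> rp c0 lc /(not_outlying_sparse rp)[e e0 he].
apply: (@le_lt_trans _ _ (Num.max 0 (1 - (l + e)))).
  apply/cmin_le; split=> [|x sx]; first by rewrite le_max lexx.
  have /andP[h _] := he x sx; apply: le_trans h.
  by rewrite ler_wpM2r ?sqr_ge0// lerBlDr -lerBlDl le_max lexx orbT.
by rewrite gt_max c0/=; lra.
Qed.

Lemma cmax_lt_of_not_outlying r l u M c : (r <= p)%N -> 0 < c -> u - 1 <= c ->
  (forall A, #|A| = r -> ~ outlying l u (gram A M)) -> cmax r M < c.
Proof.
move=> rp c0 lc /(not_outlying_sparse rp)[e e0 he].
apply: (@le_lt_trans _ _ (Num.max 0 (u - e - 1))).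
  apply/cmax_le; split=> [|x sx]; first by rewrite le_max lexx.
  have /andP[_ h] := he x sx; apply: (le_trans h).
  by rewrite ler_wpM2r ?sqr_ge0// -lerBlDl le_max lexx orbT.
by rewrite gt_max c0/=; lra.
Qed.

Lemma ric_ratio_lt s M (K : R) :
  (ric_ratio s M < K%:E)%E <-> 1 + cmax s M < K * (1 - cmin s M) /\ cmin s M < 1.
Proof.
have c1 := cmin_le1 s M; rewrite /ric_ratio; case: eqVneq => [->|ne1].
  by split=> [|[_]]; rewrite ?ltxx.
have lt1 : cmin s M < 1 by rewrite lt_neqAle ne1.
by rewrite lte_fin ltr_pdivrMr ?subr_gt0//; split=> [|[]].
Qed.

End RestrictedIsometry.

Section RestrictedIsometryMeasurable.
Context {R : realType} d (T : measurableType d) (n p : nat) (M : T -> 'M[R]_(n, p)).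
Context (mM : measurable_fun setT M).

Lemma measurable_fun_le_const (f : T -> R) :
  (forall c, measurable [set w | f w <= c]) -> measurable_fun setT f.
Proof.
move=> mf; apply: (measurability (RGenOInfty.G (R := R))) => [|_ [_ [c ->] <-]].
  exact: RGenOInfty.measurableE.
rewrite setTI (_ : _ @^-1` _ = ~` [set w | f w <= c]); first exact: measurableC.
apply/seteqP; split=> w /=; rewrite in_itv/= andbT.
  by move=> h; apply/negP; rewrite -ltNge.
by move/negP; rewrite -ltNge.
Qed.

Let measurable_const_set (P : Prop) : measurable [set _ : T | P].
Proof.
have [p1|p0] := pselect P.
  by rewrite (_ : [set _ | _] = setT)//; apply/seteqP; split.
by rewrite (_ : [set _ | _] = set0)//; apply/seteqP; split.
Qed.

Lemma measurable_cmin s : measurable_fun setT (fun w => cmin s (M w)).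
Proof.
apply: measurable_fun_le_const => c; rewrite (_ : [set _ | _] =
   [set w | 0 <= c] `&` [set w | forall x, sparse s x ->
     0 <= qform ((M w)^T *m M w - (1 - c)%:M) x]).
  apply: measurableI; first exact: measurable_const_set.
  by apply: measurable_ge_scalar; apply: measurable_gram_entry; exact: measurable_entry.
apply/seteqP; split=> w /=; rewrite cmin_le => -[c0 h]; split=> // x /h;
  by rewrite -qformB qform_gram qform_scalar subr_ge0.
Qed.

Lemma measurable_cmax s : measurable_fun setT (fun w => cmax s (M w)).
Proof.
apply: measurable_fun_le_const => c; rewrite (_ : [set _ | _] =
   [set w | 0 <= c] `&` [set w | forall x, sparse s x ->
     0 <= qform ((1 + c)%:M - (M w)^T *m M w) x]).
  apply: measurableI; first exact: measurable_const_set.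
  by apply: measurable_le_scalar; apply: measurable_gram_entry; exact: measurable_entry.
apply/seteqP; split=> w /=; rewrite cmax_le => -[c0 h]; split=> // x /h;
  by rewrite -qformB qform_gram qform_scalar subr_ge0.
Qed.

Lemma measurable_ric_ratio_lt s (K : R) :
  measurable [set w | (ric_ratio s (M w) < K%:E)%E].
Proof.
rewrite (_ : [set w | _] =
  ~` (setT `&` [set w | K * (1 - cmin s (M w)) <= 1 + cmax s (M w)]) `&`
  ~` (setT `&` [set w | 1 <= cmin s (M w)])).
  have mcmin := measurable_cmin s; have mcmax := measurable_cmax s.
  apply: measurableI; apply: measurableC; apply: measurable_fun_le => //.
    by apply: measurable_funM => //; exact: measurable_funB.
  exact: measurable_funD.
rewrite !setTI; apply/seteqP; split=> w /=; rewrite ric_ratio_lt => -[h1 h2].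
  by split; apply/negP; rewrite -ltNge.
by split; rewrite ltNge; exact/negP.
Qed.

End RestrictedIsometryMeasurable.

(** * Counting supports and the union bound *)

Section Counting.
Context {R : realType}.

(** ['C(p, r) * u ^ r * (1 - u) ^ (p - r)] is one term of the expansion of
[(1 - u + u) ^ p = 1]. *)
Lemma binomial_le_expR (p r : nat) (u : R) : 0 < u < 1 -> (r <= p)%N ->
  'C(p, r)%:R <= expR (- (r%:R * ln u + (p%:R - r%:R) * ln (1 - u))).
Proof.
move=> /andP[u0 u1] rp; have v0 : 0 < 1 - u by rewrite subr_gt0.
rewrite expRN -[_^-1]mul1r ler_pdivlMr ?expR_gt0// expRD -natrB//.
rewrite !expRM_natl !lnK ?posrE//.
apply: (@le_trans _ _ ((1 - u + u) ^+ p)); last by rewrite subrK expr1n.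
rewrite [leRHS]exprDn (bigD1 (inord r : 'I_p.+1))//= inordK ?ltnS//.
rewrite mulr_natl [u ^+ r * _]mulrC lerDl; apply: sumr_ge0 => i _.
by rewrite mulrn_wge0// mulr_ge0// exprn_ge0// ltW.
Qed.

(** The exponent of [binomial_le_expR] at the fixed value [u = rb * delta] is
linear in [r] and [p], and after division by [n] it tends to
[entropy u / delta]. *)
Lemma near_binomial_le (rb delta v : R) (p : nat -> nat) :
  0 < rb < 1 -> 0 < delta < 1 ->
  delta^-1 * entropy (rb * delta) < v ->
  (n%:R / (p n)%:R : R) @[n --> \oo] --> delta ->
  \forall n \near \oo, let r := Num.truncn (rb * n%:R) in
    (r <= p n)%N /\ 'C(p n, r)%:R <= expR (n%:R * v).
Proof.
move=> /andP[rb0 rb1] /andP[d0 d1] vH np.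
set u := rb * delta in vH.
have u01 : 0 < u < 1 by rewrite mulr_gt0//= mulr_ilt1// ltW.
have [u0 u1] := andP u01.
pose k := ln (1 - u) - ln u.
pose v0 := delta^-1 * entropy u.
have v0E : v0 = rb * k - delta^-1 * ln (1 - u).
  rewrite /v0 /entropy /k /u; field; exact: lt0r_neq0.
(* Half of the slack absorbs the convergence of [p n / n], the other half the
   rounding error in [r]. *)
pose eta := (v - v0) / 2; have eta0 : 0 < eta by rewrite divr_gt0// subr_gt0.
have pn : (rb * k - (p n)%:R / n%:R * ln (1 - u)) @[n --> \oo] --> v0.
  rewrite v0E; apply: cvgB; first exact: cvg_cst.
  apply: cvgM; last exact: cvg_cst.
  under eq_fun do rewrite -invf_div.
  exact: cvgV (lt0r_neq0 d0) np.
near=> n; cbv zeta; set r := Num.truncn _.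
have n0 : 0 < n%:R :> R by rewrite ltr0n; near: n; exact: nbhs_infty_gt.
have rn : r%:R <= rb * n%:R by rewrite truncn_le mulr_ge0// ltW.
have rn1 : rb * n%:R < r.+1%:R := truncnS_gt _.
have npn0 : 0 < n%:R / (p n)%:R :> R by near: n; exact: (cvgr_gt _ np).
have npn1 : n%:R / (p n)%:R < 1 :> R by near: n; exact: (cvgr_lt _ np).
have p0 : 0 < (p n)%:R :> R.
  by move: npn0; rewrite pmulr_rgt0// invr_gt0.
have rp : (r <= p n)%N.
  rewrite -(ler_nat R) (le_trans rn)// (@le_trans _ _ n%:R)//.
    by rewrite ler_piMl// ltW.
  by move: npn1; rewrite ltr_pdivrMr// mul1r => /ltW.
split=> //; rewrite (le_trans (binomial_le_expR u01 rp))// ler_expR.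
have h1 : rb * k - (p n)%:R / n%:R * ln (1 - u) < v0 + eta.
  by near: n; apply: (cvgr_lt _ pn); rewrite ltrDl.
have h2 : `|k| <= eta * n%:R.
  by rewrite -ler_pdivrMl// mulrC; near: n; exact: nbhs_infty_ger.
have h3 : (r%:R - rb * n%:R) * k <= `|k|.
  rewrite (le_trans (ler_norm _))// normrM ler_piMl//.
  by rewrite distrC ger0_norm ?subr_ge0// lerBlDl -[X in _ + X]/(1%:R) -natrD addn1 ltW.
have h4 : n%:R * (rb * k - (p n)%:R / n%:R * ln (1 - u)) <= n%:R * (v0 + eta).
  by rewrite ler_wpM2l// ltW.
have h5 : n%:R * (rb * k - (p n)%:R / n%:R * ln (1 - u)) =
    n%:R * rb * k - (p n)%:R * ln (1 - u) by field; exact: lt0r_neq0.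
rewrite h5 in h4.
have vE : v = v0 + eta + eta by rewrite /eta; field.
rewrite vE.
have -> : - (r%:R * ln u + ((p n)%:R - r%:R) * ln (1 - u)) =
   (r%:R - rb * n%:R) * k + (n%:R * rb * k - (p n)%:R * ln (1 - u)).
  rewrite /k; ring.
rewrite [n%:R * (_ + eta + _)]mulrDr [n%:R * eta]mulrC addrC lerD//.
exact: le_trans h3 h2.
Unshelve. all: by end_near. Qed.

(** Equivalent to [- (1 - u) * ln (1 - u) <= u]; divided by [delta] at
[u = rb * delta], it turns the explicit condition on [delta] into an entropy
condition. *)
Lemma entropy_le (u : R) : 0 < u < 1 -> entropy u <= u * (1 - ln u).
Proof.
move=> /andP[u0 u1]; have v0 : 0 < 1 - u by rewrite subr_gt0.
have : - ln (1 - u) <= u / (1 - u).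
  rewrite -lnV ?posrE//; have := @le_ln1Dx R (u / (1 - u)).
  have -> : 1 + u / (1 - u) = (1 - u)^-1 by field; exact: lt0r_neq0.
  by apply; rewrite (@lt_le_trans _ _ 0)// ?divr_ge0 ?ltW// ltrN10.
rewrite ler_pdivlMr// /entropy => h; lra.
Qed.

Lemma measure_finU_le d (T : measurableType d) (P : {measure set T -> \bar R})
    (I : finType) (Q : pred I) (E : I -> set T) (b : R) :
  (forall i, Q i -> measurable (E i)) ->
  (forall i, Q i -> (P (E i) <= b%:E)%E) ->
  measurable [set w | exists2 i, Q i & E i w] /\
  (P [set w | exists2 i, Q i & E i w] <= (#|Q|%:R * b)%:E)%E.
Proof.
move=> mE PE.
have -> : [set w | exists2 i, Q i & E i w] =
    \big[setU/set0]_(i <- enum Q) E i.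
  rewrite -bigcup_seq; apply/seteqP; split=> w [i Qi Ei]; exists i => //.
    by rewrite /= mem_enum.
  by move: Qi; rewrite /= mem_enum.
rewrite cardE; have : {subset enum Q <= Q} by move=> i; rewrite mem_enum.
elim: (enum Q) => [_|i s IH sQ].
  by rewrite big_nil mul0r measure0.
have [|ms Ps] := IH; first by move=> j js; apply: sQ; rewrite inE js orbT.
have Qi : Q i by apply: sQ; rewrite mem_head.
rewrite big_cons; split; first by apply: measurableU => //; exact: mE.
rewrite (le_trans (measureU2 _ _ _))//=; first exact: mE.
by rewrite -natr1 mulrDl mul1r addrC EFinD leeD// PE.
Qed.

End Counting.

(** * The constants rho0 and tau0 *)

Section Constants.
Context {R : realType}.
Local Notation s41 := (Num.sqrt 41 : R).

Lemma sqr_sqrt41 : s41 ^+ 2 = 41.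
Proof. by rewrite sqr_sqrtr. Qed.

Lemma sqrt41_bounds : 32 / 5 < s41 < 13 / 2.
Proof.
have h := sqr_sqrt41; have s0 : 0 <= s41 by exact: sqrtr_ge0.
by apply/andP; split; rewrite ltNge; apply/negP => ?; nra.
Qed.

Lemma rho0_bounds : 0 < (rho0 : R) < 16^-1.
Proof. by have /andP[] := sqrt41_bounds; rewrite /rho0 => *; apply/andP; split; lra. Qed.

Lemma tau0_gt0 : 0 < (tau0 : R).
Proof. by rewrite divr_gt0// sqrtr_gt0. Qed.

Lemma rho0_root : 8 * (rho0 : R) ^+ 2 - 33 * rho0 + 2 = 0.
Proof. by rewrite /rho0; have := sqr_sqrt41 => h; nra. Qed.

(** Up to the factor [tau0], the sum of the two roots of the threshold polynomial
in [sqrt rho].  Both sides are nonnegative, and the squares agree because of the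
quadratic equation satisfied by [rho0]. *)
Lemma tau0_sqrt_rho0 :
  tau0 * (Num.sqrt rho0 + (2 * Num.sqrt rho0)^-1) = Num.sqrt 2 :> R.
Proof.
have /andP[r0 _] := rho0_bounds; have a0 : 0 < Num.sqrt (rho0 : R) by rewrite sqrtr_gt0.
set y := LHS; have y0 : 0 <= y.
  by rewrite mulr_ge0 ?ltW ?tau0_gt0 ?addr_gt0 ?invr_gt0 ?mulr_gt0.
rewrite -(ger0_norm y0) -sqrtr_sqr; congr Num.sqrt.
have -> : y ^+ 2 = tau0 ^+ 2 * ((4 * rho0 ^+ 2 + 4 * rho0 + 1) / (4 * rho0)).
  rewrite /y; move: a0 (sqr_sqrtr (ltW r0)); move: (Num.sqrt rho0) => a a0 <-.
  by field; rewrite lt0r_neq0.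
have -> : tau0 ^+ 2 = 16 / 41 :> R.
  by rewrite /tau0 expr_div_n sqr_sqrt41; field.
have -> : 4 * rho0 ^+ 2 + 4 * rho0 + 1 = 41 / 2 * rho0 :> R.
  by have := rho0_root => h; lra.
by field; rewrite lt0r_neq0.
Qed.

(** Both sides are quadratic polynomials in [sqrt rho]; Vieta's relations compare
them, [tau0_sqrt_rho0] giving the sum of the roots. *)
Lemma threshold_eq (rho : R) : 0 < rho ->
  2 * tau0 * (Num.sqrt rho - Num.sqrt rho0) * (Num.sqrt rho - (2 * Num.sqrt rho0)^-1)
  = tau0 * (1 + Num.sqrt (2 * rho) ^+ 2) - 2 * Num.sqrt (2 * rho).
Proof.
move=> rho_gt0; have /andP[r0 _] := rho0_bounds.
have a0 : 0 < Num.sqrt (rho0 : R) by rewrite sqrtr_gt0.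
rewrite [Num.sqrt (2 * rho)]sqrtrM// exprMn (sqr_sqrtr (ler0n _ 2)).
by rewrite -tau0_sqrt_rho0; field; rewrite lt0r_neq0.
Qed.

Lemma threshold_bounds (rho : R) : 0 < rho < rho0 ->
  0 <= 2 * tau0 * (Num.sqrt rho - Num.sqrt rho0) *
    (Num.sqrt rho - (2 * Num.sqrt rho0)^-1) < tau0.
Proof.
move=> /andP[rho_gt0 rho_lt]; have /andP[r0 r1] := rho0_bounds.
have a0 : 0 < Num.sqrt (rho0 : R) by rewrite sqrtr_gt0.
have t0 := tau0_gt0.
have xa : Num.sqrt rho < Num.sqrt rho0 by rewrite ltr_sqrt.
apply/andP; split.
  rewrite -mulrA mulr_ge0//; first by rewrite mulr_ge0// ltW.
  rewrite ltW// nmulr_rgt0 subr_lt0// (lt_trans xa)//.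
  rewrite -(ltr_pM2r a0) -expr2 sqr_sqrtr ?(ltW r0)// invfM -mulrA mulVf ?gt_eqF//.
  by rewrite mulr1; lra.
rewrite threshold_eq//; set q := Num.sqrt _.
have q0 : 0 < q by rewrite sqrtr_gt0 mulr_gt0.
have q2 : q ^+ 2 = 2 * rho by rewrite sqr_sqrtr// mulr_ge0// ltW.
have q1 : q < 1 by rewrite -[1]sqrtr1 ltr_sqrt//; lra.
have t1 : tau0 < 1 :> R.
  rewrite /tau0 ltr_pdivrMr ?sqrtr_gt0// mul1r.
  by have /andP[+ _] := sqrt41_bounds; lra.
have : tau0 * q ^+ 2 < 2 * q by rewrite expr2 mulrA ltr_pM2r//; nra.
by rewrite mulrDr mulr1; lra.
Qed.

(** Rests on [tau0 = (K - 1) / (K + 1)]. *)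
Lemma ratio_bound_identity (q : R) :
  let K := (4 + s41) ^+ 2 / 25 in let t := tau0 * (1 + q ^+ 2) - 2 * q in
  K * ((1 - q) ^+ 2 - t) = (1 + q) ^+ 2 + t.
Proof.
move=> K t; have tauK : tau0 * (K + 1) = K - 1.
  have s0 : s41 != 0 by rewrite lt0r_neq0 ?sqrtr_gt0.
  have h := sqr_sqrt41; apply: (mulfI s0).
  rewrite /tau0 mulrA [s41 * _]mulrC divfK// /K; nra.
have : t * (K + 1) = (K - 1) * (1 + q ^+ 2) - 2 * q * (K + 1).
  by rewrite -tauK /t; ring.
by move: (t) => u h; lra.
Qed.

End Constants.

(** * The deterministic bound on the ratio *)

Section RatioBound.
Context {R : realType}.

Lemma ric_ratio_ltS n p s s' (M : 'M[R]_(n, p)) (K : R) : 0 < K -> (s <= s')%N ->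
  (ric_ratio s' M < K%:E)%E -> (ric_ratio s M < K%:E)%E.
Proof.
move=> K0 ss /ric_ratio_lt[h1 h2]; apply/ric_ratio_lt; split.
  rewrite (le_lt_trans _ (lt_le_trans h1 _))//; first by rewrite lerD2l cmaxS.
  by rewrite ler_pM2l// lerB// cminS.
by rewrite (le_lt_trans _ h2)// cminS.
Qed.

Lemma ric_ratio_lt_of_not_outlying n p r (M : 'M[R]_(n, p)) (q : R) :
  let t := tau0 * (1 + q ^+ 2) - 2 * q in
  (r <= p)%N -> 0 < q < 1 -> 0 <= t ->
  (forall A : {set 'I_p}, #|A| = r ->
     ~ outlying ((1 - q) ^+ 2 - t) ((1 + q) ^+ 2 + t) (gram A M)) ->
  (ric_ratio r M < ((4 + Num.sqrt 41) ^+ 2 / 25)%:E)%E.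
Proof.
move=> t rp /andP[q0 q1] t0 hA; have := ratio_bound_identity q; cbv zeta; rewrite -/t.
set K := _ / 25 => KE.
have K0 : 0 < K by rewrite divr_gt0// exprn_gt0// ltr_wpDr// sqrtr_ge0.
have hmin : cmin r M < 1 - ((1 - q) ^+ 2 - t).
  by apply: cmin_lt_of_not_outlying rp _ _ hA => //; nra.
have hmax : cmax r M < (1 + q) ^+ 2 + t - 1.
  by apply: cmax_lt_of_not_outlying rp _ _ hA => //; nra.
have l0 : 0 < (1 - q) ^+ 2 - t by rewrite -(pmulr_rgt0 _ K0) KE; nra.
apply/ric_ratio_lt; split; last by lra.
apply: (@lt_trans _ _ ((1 + q) ^+ 2 + t)); first by lra.
by rewrite -KE ltr_pM2l//; lra.
Qed.

End RatioBound.

(** * Deviations under the covariance model *)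

Section CovarianceModel.
Context {R : realType}.
Context (dC : nat -> nat -> measure_display)
  (TC : forall r n : nat, measurableType (dC r n))
  (PC : forall r n : nat, probability (TC r n) R)
  (C : forall r n : nat, {RV PC r n >-> 'M[R]_r})
  (W : R -> R -> R) (n0 : R -> nat) (c : R -> R)
  (C_cov : forall (r n : nat) (w : TC r n), covariance_mx (C r n w))
  (c_gt0 : forall rb : R, 0 < rb < 2 * rho0 -> 0 < c rb)
  (C_deviation : forall rb : R, 0 < rb < 2 * rho0 ->
     forall n : nat, (n0 rb <= n)%N ->
     let r := Num.truncn (rb * n%:R) in (0 < r)%N ->
     forall t : R, 0 <= t < tau0 ->
     (PC r n [set w | (t <= Num.max
          (lambda_max (C r n w) - (1 + Num.sqrt rb) ^+ 2)
          ((1 - Num.sqrt rb) ^+ 2 - lambda_min (C r n w)))%R]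
      <= (c rb * expR (- (n%:R * W rb t)))%:E)%E).

Definition gram_deviation d (T : measurableType d) n p (M : T -> 'M[R]_(n, p)) (rb t : R) :=
  [set w | exists2 A : {set 'I_p}, #|A| == Num.truncn (rb * n%:R) &
    outlying ((1 - Num.sqrt rb) ^+ 2 - t) ((1 + Num.sqrt rb) ^+ 2 + t) (gram A (M w))].

Lemma not_gram_deviation d (T : measurableType d) n p (M : T -> 'M[R]_(n, p)) rb t w :
  ~ gram_deviation M rb t w -> forall A : {set 'I_p}, #|A| = Num.truncn (rb * n%:R) ->
  ~ outlying ((1 - Num.sqrt rb) ^+ 2 - t) ((1 + Num.sqrt rb) ^+ 2 + t) (gram A (M w)).
Proof. by move=> nbad A /eqP Ar outA; apply: nbad; exists A. Qed.

Lemma measurable_outlying_gram d (T : measurableType d) n p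
    (M : T -> 'M[R]_(n, p)) A l u : measurable_fun setT M ->
  measurable [set w | outlying l u (gram A (M w))].
Proof.
move=> mM; apply: measurable_outlying => i j; rewrite /gram.
apply: measurable_gram_entry => k l'; under eq_fun do rewrite mxE.
exact: measurable_entry.
Qed.

(** [C] is symmetric, so the event read off from its extreme eigenvalues is
membership in the measurable set [outlying], on which the law of [C] and that of
the Gram matrix agree. *)
Lemma probability_outlying_gram d (T : measurableType d) (P : probability T R)
    n p (M : T -> 'M[R]_(n, p)) (A : {set 'I_p}) rb t :
  covariance_model PC C P M -> 0 < rb < 2 * rho0 -> (n0 rb <= n)%N ->
  (0 < Num.truncn (rb * n%:R))%N -> #|A| = Num.truncn (rb * n%:R) ->
  0 <= t < tau0 ->
  (P [set w | outlying ((1 - Num.sqrt rb) ^+ 2 - t) ((1 + Num.sqrt rb) ^+ 2 + t)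
      (gram A (M w))] <= (c rb * expR (- (n%:R * W rb t)))%:E)%E.
Proof.
move=> model rb0 n0n r0 Ar t0; set l := _ - t; set u := _ + t.
have rn : (Num.truncn (rb * n%:R))%:Z <= Num.ceil (2 * rho0 * n%:R : R).
  rewrite -(ler_int R) (le_trans _ (ceil_ge _))//.
  have /andP[rbp rbr] := rb0; apply: (@le_trans _ _ (rb * n%:R)).
    by rewrite truncn_le mulr_ge0// ltW.
  by rewrite ler_wpM2r// ltW.
have mout : measurable (outlying l u : set 'M[R]_#|A|).
  apply: (@measurable_outlying _ _ _ _ _ _ id) => i j.
  exact: measurable_mx_entry.
have -> : [set w | outlying l u (gram A (M w))] =
  (fun w => (cols A (M w))^T *m cols A (M w)) @^-1` outlying l u by [].
rewrite (model _ r0 rn A Ar _ mout).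
have := C_deviation rb0 n0n r0 t0; rewrite -Ar; congr (PC _ _ _ <= _)%E.
have A0 : (0 < #|A|)%N by rewrite Ar.
apply/seteqP; split=> w /=; have [symC _] := C_cov w.
  by move/(outlying_lambda _ _ _ A0 symC).
by move=> h; apply/(outlying_lambda _ _ _ A0 symC).
Qed.

(** The union bound over the ['C(p n, r)] column sets: the counting exponent
[W rb t - D] leaves the rate [D]. *)
Lemma near_gram_deviation (rb delta t D : R) :
  0 < rb < 2 * rho0 -> 0 < delta < 1 -> 0 <= t < tau0 ->
  delta^-1 * entropy (rb * delta) + D < W rb t ->
  forall (p : nat -> nat)
    (d : nat -> measure_display) (T : forall n, measurableType (d n))
    (P : forall n, probability (T n) R)
    (M : forall n, {RV P n >-> 'M[R]_(n, p n)}),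
  (n%:R / (p n)%:R : R) @[n --> \oo] --> delta ->
  (forall n : nat, (2 <= n)%N -> covariance_model PC C (P n) (M n)) ->
  \forall n \near \oo, [/\ (Num.truncn (rb * n%:R) <= p n)%N,
    measurable (gram_deviation (M n) rb t) &
    (P n (gram_deviation (M n) rb t) <= (c rb * expR (- (n%:R * D)))%:E)%E].
Proof.
move=> rb0 delta0 t0 DW p d T P M np model.
have [rb_gt0 rb_lt] := andP rb0.
have rb1 : 0 < rb < 1.
  by rewrite rb_gt0/=; have /andP[_] := @rho0_bounds R; lra.
have /(near_binomial_le rb1 delta0)/(_ np) near_count :
  delta^-1 * entropy (rb * delta) < W rb t - D by rewrite ltrBrDr.
near=> n.
have [rp count] : let r := Num.truncn (rb * n%:R) in
    (r <= p n)%N /\ 'C(p n, r)%:R <= expR (n%:R * (W rb t - D)).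
  by near: n; exact: near_count.
have n2 : (2 <= n)%N by near: n; exact: nbhs_infty_ge.
have n0n : (n0 rb <= n)%N by near: n; exact: nbhs_infty_ge.
have r0 : (0 < Num.truncn (rb * n%:R))%N.
  rewrite truncn_gt0 mulrC -ler_pdivrMr// div1r.
  by near: n; exact: nbhs_infty_ger.
have cb := c_gt0 rb0.
have [|A /eqP Ar|mbad Pbad] := @measure_finU_le R _ _ (P n) {set 'I_(p n)}
   (fun A => #|A| == Num.truncn (rb * n%:R)) (fun A => [set w | outlying
    ((1 - Num.sqrt rb) ^+ 2 - t) ((1 + Num.sqrt rb) ^+ 2 + t) (gram A (M n w))])
   (c rb * expR (- (n%:R * W rb t))).
- by move=> A _; exact: measurable_outlying_gram.
- exact: probability_outlying_gram (model n n2) _ _ _ _ _.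
split=> //; apply: (le_trans Pbad); rewrite lee_fin.
rewrite -cardsE card_draws card_ord mulrCA ler_pM2l//.
rewrite (le_trans (ler_wpM2r (expR_ge0 _) count))// -expRD ler_expR; lra.
Unshelve. all: by end_near. Qed.

Lemma restricted_isometry_ratio (delta rho : R) :
  0 < delta < 1 -> 0 < rho < rho0 ->
  delta > (2 * rho)^-1 * expR (1 - (2 * rho)^-1 *
       W (2 * rho) (2 * tau0 * (Num.sqrt rho - Num.sqrt rho0) *
                    (Num.sqrt rho - (2 * Num.sqrt rho0)^-1))) ->
  exists2 D1 : R, 0 < D1 &
     forall (p : nat -> nat)
       (d : nat -> measure_display) (T : forall n, measurableType (d n))
       (P : forall n, probability (T n) R)
       (M : forall n, {RV P n >-> 'M[R]_(n, p n)}),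
     (n%:R / (p n)%:R : R) @[n --> \oo] --> delta ->
     (forall n : nat, (2 <= n)%N -> covariance_model PC C (P n) (M n)) ->
     let good n := [set w | forall s : nat,
       (1 <= s <= Num.truncn (rho * n%:R))%N ->
       (ric_ratio (2 * s)%N (M n w)
         < ((4 + Num.sqrt 41) ^+ 2 / 25)%:E)%E] in
     (\forall n \near \oo,
       (P n (good n) >= (1 - 2 * c (2 * rho) * expR (- (n%:R * D1)))%:E)%E)
     /\ P n (good n) @[n --> \oo] --> 1%E.
Proof.
move=> delta0 rho0b; set t := 2 * tau0 * _ * _; set rb := 2 * rho => hdelta.
have [rho_gt0 rho_lt] := andP rho0b; have [d0 d1] := andP delta0.
have rb0 : 0 < rb < 2 * rho0 by rewrite /rb; apply/andP; split; lra.
have [rb_gt0 _] := andP rb0.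
have u01 : 0 < rb * delta < 1.
  rewrite mulr_gt0//= mulr_ilt1// ?ltW//.
  by have /andP[_] := @rho0_bounds R; have [_] := andP rb0; lra.
have HW : delta^-1 * entropy (rb * delta) < W rb t.
  apply: (@le_lt_trans _ _ (rb * (1 - ln (rb * delta)))).
    by rewrite ler_pdivrMl// mulrA [delta * _]mulrC entropy_le.
  have : 1 - rb^-1 * W rb t < ln (rb * delta).
    by rewrite -ltr_expR lnK ?posrE; [rewrite -ltr_pdivrMl|case/andP: u01].
  by rewrite -ltr_pdivlMl//; lra.
have t0 : 0 <= t < tau0 by exact: threshold_bounds.
have cb := c_gt0 rb0.
(* Half of the gap in [HW] goes to the rate, the other half to the count. *)
pose D := (W rb t - delta^-1 * entropy (rb * delta)) / 2.
have D0 : 0 < D by rewrite divr_gt0// subr_gt0.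
exists D => // p d T P M np model good.
have mgood n : measurable (good n).
  rewrite (_ : good n = [set w | forall s : nat, [set w |
     (1 <= s <= Num.truncn (rho * n%:R))%N ->
     (ric_ratio (2 * s)%N (M n w) < ((4 + Num.sqrt 41) ^+ 2 / 25)%:E)%E] w])//.
  apply: (@measurable_forall_count _ _ nat) => s.
  have [hs|hs] := boolP (1 <= s <= Num.truncn (rho * n%:R))%N.
    rewrite (_ : [set w | _] = [set w | (ric_ratio (2 * s)%N (M n w) <
      ((4 + Num.sqrt 41) ^+ 2 / 25)%:E)%E]); first exact: measurable_ric_ratio_lt.
    by apply/seteqP; split=> w //= /(_ isT).
  rewrite (_ : [set w | _] = setT); first exact: measurableT.
  by apply/seteqP; split=> w //= _ ; rewrite (negPf hs).
have bound : \forall n \near \oo,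
    ((1 - 2 * c rb * expR (- (n%:R * D)))%:E <= P n (good n))%E.
  have DW : delta^-1 * entropy (rb * delta) + D < W rb t by rewrite /D; lra.
  have nb := near_gram_deviation rb0 delta0 t0 DW np model.
  near=> n.
  have [rp mbad Pbad] : [/\ (Num.truncn (rb * n%:R) <= p n)%N,
      measurable (gram_deviation (M n) rb t) &
      (P n (gram_deviation (M n) rb t) <= (c rb * expR (- (n%:R * D)))%:E)%E].
    by near: n; exact: nb.
  rewrite -[good n]setCK probability_setC; last exact: measurableC.
  rewrite EFinB leeB//.
  apply: (@le_trans _ _ (P n (gram_deviation (M n) rb t))).
    apply: le_measure; rewrite ?inE//; first exact: measurableC.
    (* Constants of order [2 * s] are bounded by those of order
       [truncn (2 * rho * n)], the only order at which Gram matrices are used. *)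
    move=> w ngood; apply: contrapT => nbad; apply: ngood => s /andP[s1 sr].
    have {sr} sr : (2 * s <= Num.truncn (rb * n%:R))%N.
      have sn : s%:R <= rho * n%:R by rewrite -truncn_ge_nat// mulr_ge0// ltW.
      rewrite truncn_ge_nat; last by rewrite mulr_ge0// ltW.
      by rewrite natrM /rb -mulrA ler_pM2l.
    apply: (ric_ratio_ltS _ sr).
      by rewrite divr_gt0// exprn_gt0// ltr_wpDr// sqrtr_ge0.
    move: (not_gram_deviation nbad) (andP t0).1; rewrite /t threshold_eq// -/rb.
    move=> hA tge0; apply: ric_ratio_lt_of_not_outlying hA => //.
    rewrite sqrtr_gt0 rb_gt0 -[ltRHS]sqrtr1 ltr_sqrt//.
    by have /andP[_] := @rho0_bounds R; have [_] := andP rb0; lra.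
  apply: (le_trans Pbad); rewrite lee_fin -mulrA.
  by rewrite ler_peMl ?mulr_ge0 ?expR_ge0 ?(ltW cb)// ler1n.
split=> //.
apply: (@squeeze_cvge _ _ _ _ (fun n => (1 - 2 * c rb * expR (- (n%:R * D)))%:E)
  _ (cst 1%E)); last exact: cvg_cst.
  near=> n; apply/andP; split; last exact: probability_le1.
  by near: n; exact: bound.
apply: cvg_EFin; first exact: nearW.
rewrite -[X in _ --> X]subr0; apply: cvgB; first exact: cvg_cst.
rewrite -(mulr0 (2 * c rb)); apply: cvgM; first exact: cvg_cst.
under eq_fun do rewrite -mulrN expRM_natl.
by apply: cvg_expr; rewrite ger0_norm ?expR_ge0// -expR0 ltr_expR oppr_lt0.
Unshelve. all: by end_near. Qed.

Lemma restricted_isometry_constants (eps rb delta : R) :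
  (forall rb : R, 0 < rb < 2 * rho0 ->
     {in `[0, tau0[ &, {homo W rb : s t / s < t}}) ->
  0 < eps -> 0 < rb < 2 * rho0 -> 0 < delta < 1 ->
     (W rb @` `[0, tau0[) (delta^-1 * entropy (rb * delta)) ->
     let t0 := rate_inv (W rb) (delta^-1 * entropy (rb * delta)) in
     exists2 D2 : R, 0 < D2 &
     forall (p : nat -> nat)
       (d : nat -> measure_display) (T : forall n, measurableType (d n))
       (P : forall n, probability (T n) R)
       (M : forall n, {RV P n >-> 'M[R]_(n, p n)}),
     (n%:R / (p n)%:R : R) @[n --> \oo] --> delta ->
     (forall n : nat, (2 <= n)%N -> covariance_model PC C (P n) (M n)) ->
     \forall n \near \oo,
       (P n [set w | (cmin (Num.truncn (rb * n%:R)) (M n w)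
                      >= Num.sqrt rb * (2 - Num.sqrt rb) + t0 + eps)%R]
          <= (c rb * expR (- (n%:R * D2)))%:E)%E /\
       (P n [set w | (cmax (Num.truncn (rb * n%:R)) (M n w)
                      >= Num.sqrt rb * (2 + Num.sqrt rb) + t0 + eps)%R]
          <= (c rb * expR (- (n%:R * D2)))%:E)%E.
Proof.
move=> Wincr eps0 rb0 delta0 inW t0.
have [rb_gt0 rb_lt] := andP rb0.
have /andP[t0_ge0 t0_lt] : 0 <= t0 < tau0.
  case: inW => s s0 Ws; suff -> : t0 = s by move: s0; rewrite /= in_itv.
  rewrite /t0 -Ws /rate_inv pinvKV ?inE// => x y; rewrite !inE => x0 y0 Wxy.
  have [xy|xy|//] := ltgtP x y.
    by have := Wincr _ rb0 _ _ x0 y0 xy; rewrite Wxy ltxx.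
  by have := Wincr _ rb0 _ _ y0 x0 xy; rewrite Wxy ltxx.
have Wt0 : W rb t0 = delta^-1 * entropy (rb * delta) by apply: pinvK; rewrite inE.
(* [t0 + eps] may leave the range [0, tau0) of the deviation bound. *)
pose e := Num.min eps (tau0 - t0) / 2.
have e0 : 0 < e by rewrite divr_gt0// lt_min eps0 subr_gt0.
have [e_eps e_tau] : e < eps /\ t0 + e < tau0.
  have : Num.min eps (tau0 - t0) <= eps by rewrite ge_min lexx.
  have : Num.min eps (tau0 - t0) <= tau0 - t0 by rewrite ge_min lexx orbT.
  by rewrite /e in e0 *; split; lra.
have te : 0 <= t0 + e < tau0 by rewrite e_tau andbT addr_ge0// ltW.
have WW : W rb t0 < W rb (t0 + e).
  by apply: Wincr => //; rewrite ?in_itv/= ?t0_ge0// ltrDl.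
pose D := (W rb (t0 + e) - W rb t0) / 2.
have D0 : 0 < D by rewrite divr_gt0// subr_gt0.
exists D => // p d T P M np model.
have nb : delta^-1 * entropy (rb * delta) + D < W rb (t0 + e) by rewrite -Wt0 /D; lra.
have {}nb := near_gram_deviation rb0 delta0 te nb np model.
near=> n.
have [rp mbad Pbad] : [/\ (Num.truncn (rb * n%:R) <= p n)%N,
    measurable (gram_deviation (M n) rb (t0 + e)) &
    (P n (gram_deviation (M n) rb (t0 + e)) <= (c rb * expR (- (n%:R * D)))%:E)%E].
  by near: n; exact: nb.
set q := Num.sqrt rb in mbad Pbad *.
have q0 : 0 < q by rewrite sqrtr_gt0.
have q1 : q < 1.
  by rewrite -[1]sqrtr1 ltr_sqrt//; have /andP[_] := @rho0_bounds R; lra.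
split; apply: le_trans Pbad; apply: le_measure; rewrite ?inE//.
- rewrite -[X in measurable X]setTI; apply: measurable_fun_le => //.
  exact: measurable_cmin.
- move=> w /= h; apply: contrapT => nbad; move: h; apply/negP; rewrite -ltNge.
  apply: cmin_lt_of_not_outlying rp _ _ (not_gram_deviation nbad); rewrite -/q; nra.
- rewrite -[X in measurable X]setTI; apply: measurable_fun_le => //.
  exact: measurable_cmax.
- move=> w /= h; apply: contrapT => nbad; move: h; apply/negP; rewrite -ltNge.
  apply: cmax_lt_of_not_outlying rp _ _ (not_gram_deviation nbad); rewrite -/q; nra.
Unshelve. all: by end_near. Qed.

End CovarianceModel.

Unset Implicit Arguments.

Theorem theorem2 (R : realType)
  (dC : nat -> nat -> measure_display)
  (TC : forall r n : nat, measurableType (dC r n))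
  (PC : forall r n : nat, probability (TC r n) R)
  (C : forall r n : nat, {RV PC r n >-> 'M[R]_r})
  (W : R -> R -> R) (n0 : R -> nat) (c : R -> R)
  (C_cov : forall (r n : nat) (w : TC r n), covariance_mx (C r n w))
  (n0_ge2 : forall rb : R, 0 < rb < 2 * rho0 -> (2 <= n0 rb)%N)
  (c_gt0 : forall rb : R, 0 < rb < 2 * rho0 -> 0 < c rb)
  (W_continuous : forall rb : R, 0 < rb < 2 * rho0 ->
     {within `[0, tau0[, continuous (W rb)})
  (W_increasing : forall rb : R, 0 < rb < 2 * rho0 ->
     {in `[0, tau0[ &, {homo W rb : s t / s < t}})
  (W0 : forall rb : R, 0 < rb < 2 * rho0 -> W rb 0 = 0)
  (* for r = 0 there are no eigenvalues, hence the guard 0 < r *)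
  (C_deviation : forall rb : R, 0 < rb < 2 * rho0 ->
     forall n : nat, (n0 rb <= n)%N ->
     let r := Num.truncn (rb * n%:R) in (0 < r)%N ->
     forall t : R, 0 <= t < tau0 ->
     (PC r n [set w | (t <= Num.max
          (lambda_max (C r n w) - (1 + Num.sqrt rb) ^+ 2)
          ((1 - Num.sqrt rb) ^+ 2 - lambda_min (C r n w)))%R]
      <= (c rb * expR (- (n%:R * W rb t)))%:E)%E) :
  (forall delta rho : R, 0 < delta < 1 -> 0 < rho < rho0 ->
     delta > (2 * rho)^-1 * expR (1 - (2 * rho)^-1 *
       W (2 * rho) (2 * tau0 * (Num.sqrt rho - Num.sqrt rho0) *
                    (Num.sqrt rho - (2 * Num.sqrt rho0)^-1))) ->
     exists2 D1 : R, 0 < D1 &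
     forall (p : nat -> nat)
       (d : nat -> measure_display) (T : forall n, measurableType (d n))
       (P : forall n, probability (T n) R)
       (M : forall n, {RV P n >-> 'M[R]_(n, p n)}),
     (n%:R / (p n)%:R : R) @[n --> \oo] --> delta ->
     (forall n : nat, (2 <= n)%N -> covariance_model PC C (P n) (M n)) ->
     let good n := [set w | forall s : nat,
       (1 <= s <= Num.truncn (rho * n%:R))%N ->
       (ric_ratio (2 * s)%N (M n w)
         < ((4 + Num.sqrt 41) ^+ 2 / 25)%:E)%E] in
     (\forall n \near \oo,
       (P n (good n) >= (1 - 2 * c (2 * rho) * expR (- (n%:R * D1)))%:E)%E)
     /\ P n (good n) @[n --> \oo] --> 1%E)
  /\
  (forall eps rb delta : R, 0 < eps -> 0 < rb < 2 * rho0 -> 0 < delta < 1 ->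
     (W rb @` `[0, tau0[) (delta^-1 * entropy (rb * delta)) ->
     let t0 := rate_inv (W rb) (delta^-1 * entropy (rb * delta)) in
     exists2 D2 : R, 0 < D2 &
     forall (p : nat -> nat)
       (d : nat -> measure_display) (T : forall n, measurableType (d n))
       (P : forall n, probability (T n) R)
       (M : forall n, {RV P n >-> 'M[R]_(n, p n)}),
     (n%:R / (p n)%:R : R) @[n --> \oo] --> delta ->
     (forall n : nat, (2 <= n)%N -> covariance_model PC C (P n) (M n)) ->
     \forall n \near \oo,
       (P n [set w | (cmin (Num.truncn (rb * n%:R)) (M n w)
                      >= Num.sqrt rb * (2 - Num.sqrt rb) + t0 + eps)%R]
          <= (c rb * expR (- (n%:R * D2)))%:E)%E /\
       (P n [set w | (cmax (Num.truncn (rb * n%:R)) (M n w)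
                      >= Num.sqrt rb * (2 + Num.sqrt rb) + t0 + eps)%R]
          <= (c rb * expR (- (n%:R * D2)))%:E)%E).
Proof.
split=> [delta rho d01 rho01 hdelta|eps rb delta eps0 rb0 d01 inW t0].
  exact: (restricted_isometry_ratio C_cov c_gt0 C_deviation d01 rho01 hdelta).
exact: (restricted_isometry_constants C_cov c_gt0 C_deviation W_increasing
  eps0 rb0 d01 inW).
Qed.
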